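(* Let $\mathbf{k}$ be a field, let $G,G'$ be $2$-edge connected finite graphs, and let $v_0\in V(G)$, $v_0'\in V(G')$ be base-points. Let $\phi:\overrightarrow{E}(G)\rightarrow \overrightarrow{E}(G')$ be a bijective map of oriented edges. If we have the following equality of subalgebras of $\mathbf{k}[F_{E(G')}]/J_{F_{E(G')}}^3$: \[\phi_*\bigl(w_*(\mathbf{k}[\pi_1(G,v_0)]/J_{\pi_1(G,v_0)}^3)\bigr)=w'_*\bigl(\mathbf{k}[\pi_1(G',v'_0)]/J_{\pi_1(G',v'_0)}^3\bigr),\] then $\phi$ is a graph isomorphism satisfying $\phi(v_0)=v'_0$.
   Context: Graphs may have self-edges (loops) and parallel edges. A graph is $2$-edge connected if it is connected and has no cut edge (bridge). Oriented edges: $\overrightarrow{E}(G)$ is the set of oriented edges of $G$; each edge $e\in E(G)$, including each self-edge, gives exactly two elements of $\overrightarrow{E}(G)$, which are exchanged by orientation reversal $e\mapsto e^{-1}$. Each oriented edge has an initial and a terminal vertex, swapped by reversal (and equal for a self-edge). A bijective map of oriented edges is a bijection $\phi:\overrightarrow{E}(G)\to\overrightarrow{E}(G')$ with $\phi(e^{-1})=\phi(e)^{-1}$ for all $e$; no compatibility with incidence is required. Saying that $\phi$ is a graph isomorphism with $\phi(v_0)=v_0'$ means that there is a bijection $V(G)\to V(G')$, also denoted $\phi$, such that for every oriented edge $e$ of $G$ with initial vertex $x$ and terminal vertex $y$, the oriented edge $\phi(e)$ has initial vertex $\phi(x)$ and terminal vertex $\phi(y)$, and this vertex map sends $v_0$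 to $v_0'$. Group algebras: for a group $\Gamma$, $\mathbf{k}[\Gamma]$ is the group algebra, and $J_\Gamma$ is its augmentation ideal, i.e. the kernel of the $\mathbf{k}$-algebra homomorphism $\varepsilon:\mathbf{k}[\Gamma]\to\mathbf{k}$ with $\varepsilon(g)=1$ for all $g\in\Gamma$. The $k$-truncation is $\mathbf{k}[\Gamma]/J_\Gamma^{k+1}$. A group homomorphism $\Gamma\to\Gamma'$ induces algebra homomorphisms $\mathbf{k}[\Gamma]/J_\Gamma^{k+1}\to\mathbf{k}[\Gamma']/J_{\Gamma'}^{k+1}$. The maps: fix an arbitrary orientation of each edge of $G$ and of $G'$. $F_{E(G)}$ is the free group on the set of edges of $G$; an oriented edge is regarded as the element $e$ of $F_{E(G)}$ if it carries the chosen orientation of the edge $e$, and as $e^{-1}$ otherwise. The group $\pi_1(G,v_0)$ is the fundamental group of $G$ based at $v_0$. The homomorphism $w:\pi_1(G,v_0)\to F_{E(G)}$ sends the class of a closed path based at $v_0$ to the product, in order, of the oriented edges it traverses. The homomorphism $w':\pi_1(G',v_0')\to F_{E(G')}$ is defined in the same way. $w_*$ and $w'_*$ are the induced maps on the truncated group algebras. The map $\phi$ induces a group homomorphism $F_{E(G)}\to F_{E(G')}$ sending each generator $e$ (with its chosen orientation) to the element of $F_{E(G')}$ corresponding to the oriented edge $\phi(e)$; $\phi_*:\mathbf{k}[F_{E(G)}]/J_{F_{E(G)}}^3\to\mathbf{k}[F_{E(G')}]/J_{F_{E(G')}}^3$ is the induced algebra homomorphism. *)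

(* Defs.v *)
From HB Require Import structures.
From mathcomp Require Import all_boot all_algebra.
From mathcomp Require Import finmap boolp classical_sets.
From mathcomp.multinomials Require Import monalg.
From Stdlib Require Import Relation_Operators.

Set Implicit Arguments.
Unset Strict Implicit.
Unset Printing Implicit Defensive.

Import GRing.Theory.

Section GeneratedQuotient.
Local Open Scope quotient_scope.
Variables (T : choiceType) (R : T -> T -> Prop).

Definition rst (x y : T) : bool := `[< clos_refl_sym_trans T R x y >].

Fact rst_equiv : equiv_class_of rst.
Proof.
split=> [x | x y | y x z].
- exact/asboolP/rst_refl.
- by apply/asboolP/asboolP; exact: rst_sym.
- by move=> /asboolP xy /asboolP yz; apply/asboolP; exact: rst_trans xy yz.
Qed.

Canonical rst_equiv_rel := EquivRelPack rst_equiv.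
Canonical rst_encModRel := defaultEncModRel rst.

Definition rst_quot := {eq_quot rst}.

HB.instance Definition _ : EqQuotient T rst rst_quot := EqQuotient.on rst_quot.
HB.instance Definition _ := Choice.on rst_quot.

Lemma rst_quotP (x y : T) :
  \pi_rst_quot x = \pi_rst_quot y <-> clos_refl_sym_trans T R x y.
Proof.
split; first by move=> /eqmodP /asboolP.
by move=> xy; apply/eqmodP/asboolP.
Qed.

Lemma rst_repr (x : T) : clos_refl_sym_trans T R (repr (\pi_rst_quot x)) x.
Proof. by apply/rst_quotP; rewrite reprK. Qed.

Lemma rst_lift (S : Type) (f : T -> S) (fR : forall x y, R x y -> f x = f y)
  (x y : T) : clos_refl_sym_trans T R x y -> f x = f y.
Proof. by elim=> {x y} // x y z _ -> _ ->. Qed.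

Lemma rst_quot_lift (S : Type) (f : T -> S) (fR : forall x y, R x y -> f x = f y)
  (x : T) : f (repr (\pi_rst_quot x)) = f x.
Proof. exact: rst_lift (rst_repr x). Qed.

End GeneratedQuotient.

(** The letters [x] and [x^-1] are encoded as [(x, true)] and [(x, false)]. *)

Section Words.
Variable X : Type.
Implicit Types (d : X * bool) (p q u v w : seq (X * bool)).

Definition inv_letter d : X * bool := (d.1, ~~ d.2).

Definition inv_word w : seq (X * bool) := rev (map inv_letter w).

Definition cancels u v : Prop :=
  exists p d q, u = p ++ [:: d, inv_letter d & q] /\ v = p ++ q.

Lemma inv_letterK : involutive inv_letter.
Proof. by case=> x b; rewrite /inv_letter /= negbK. Qed.

Lemma inv_word_cons d w : inv_word (d :: w) = inv_word w ++ [:: inv_letter d].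
Proof. by rewrite /inv_word /= rev_cons -cats1. Qed.

Lemma inv_word_cat u v : inv_word (u ++ v) = inv_word v ++ inv_word u.
Proof. by rewrite /inv_word map_cat rev_cat. Qed.

Lemma inv_wordK : involutive inv_word.
Proof.
by move=> w; rewrite /inv_word map_rev revK (mapK inv_letterK).
Qed.

Lemma cancels_catl w u v : cancels u v -> cancels (w ++ u) (w ++ v).
Proof. by move=> [p [d [q [-> ->]]]]; exists (w ++ p), d, q; rewrite -!catA. Qed.

Lemma cancels_catr w u v : cancels u v -> cancels (u ++ w) (v ++ w).
Proof. by move=> [p [d [q [-> ->]]]]; exists p, d, (q ++ w); rewrite -!catA. Qed.

Lemma cancels_inv u v : cancels u v -> cancels (inv_word u) (inv_word v).
Proof.
move=> [p [d [q [-> ->]]]]; exists (inv_word q), d, (inv_word p).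
by rewrite !inv_word_cat !inv_word_cons -!catA /= inv_letterK.
Qed.

End Words.

Definition free_group (X : choiceType) : Type :=
  rst_quot (@cancels X : seq (X * bool) -> seq (X * bool) -> Prop).

Section FreeGroup.
Local Open Scope quotient_scope.
Local Open Scope group_scope.
Variable X : choiceType.

HB.instance Definition _ := Choice.on (free_group X).

Definition fg_class (w : seq (X * bool)) : free_group X :=
  \pi_(rst_quot (@cancels X)) w.

Lemma fg_classP u v :
  fg_class u = fg_class v <-> clos_refl_sym_trans _ (@cancels X) u v.
Proof. exact: rst_quotP. Qed.

Lemma fg_class_cancels u v : cancels u v -> fg_class u = fg_class v.
Proof. by move=> uv; apply/fg_classP/rst_step. Qed.

Lemma fg_classK (x : free_group X) : fg_class (repr x) = x.
Proof. exact: reprK. Qed.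

Definition fg_one : free_group X := fg_class [::].
Definition fg_inv (x : free_group X) : free_group X :=
  fg_class (inv_word (repr x)).
Definition fg_mul (x y : free_group X) : free_group X :=
  fg_class (repr x ++ repr y).

Lemma fg_mulE u v : fg_mul (fg_class u) (fg_class v) = fg_class (u ++ v).
Proof.
rewrite /fg_mul.
transitivity (fg_class (u ++ repr (fg_class v))).
  apply: (@rst_quot_lift _ _ _ (fun w => fg_class (w ++ _))) => {}u w uw.
  exact/fg_class_cancels/cancels_catr.
apply: (@rst_quot_lift _ _ _ (fun w => fg_class (u ++ w))) => {}v w vw.
exact/fg_class_cancels/cancels_catl.
Qed.

Lemma fg_invE u : fg_inv (fg_class u) = fg_class (inv_word u).
Proof.
apply: (@rst_quot_lift _ _ _ (fun w => fg_class (inv_word w))) => {}u w uw.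
exact/fg_class_cancels/cancels_inv.
Qed.

Fact fg_mulA : associative fg_mul.
Proof.
by move=> x y z; rewrite -[x]fg_classK -[y]fg_classK -[z]fg_classK !fg_mulE catA.
Qed.

Fact fg_mul1g : left_id fg_one fg_mul.
Proof. by move=> x; rewrite -[x]fg_classK fg_mulE. Qed.

Fact fg_mulg1 : right_id fg_one fg_mul.
Proof. by move=> x; rewrite -[x]fg_classK fg_mulE cats0. Qed.

Lemma fg_class_mulgV w : fg_class (w ++ inv_word w) = fg_one.
Proof.
elim/last_ind: w => // w d <-.
rewrite -cats1 inv_word_cat -catA; apply: fg_class_cancels.
by exists w, d, (inv_word w).
Qed.

Fact fg_mulgV : right_inverse fg_one fg_inv fg_mul.
Proof. by move=> x; rewrite -[x]fg_classK fg_invE fg_mulE fg_class_mulgV. Qed.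

Fact fg_mulVg : left_inverse fg_one fg_inv fg_mul.
Proof.
move=> x; rewrite -[x]fg_classK fg_invE fg_mulE.
by rewrite -[X in _ ++ X]inv_wordK fg_class_mulgV.
Qed.

HB.instance Definition _ := isGroup.Build (free_group X)
  fg_mulA fg_mul1g fg_mulg1 fg_mulVg fg_mulgV.

Definition fg_gen (x : X) : free_group X := fg_class [:: (x, true)].

Lemma fg_classM u v : fg_class (u ++ v) = fg_class u * fg_class v.
Proof. by rewrite -fg_mulE. Qed.

Lemma fg_classV u : fg_class (inv_word u) = (fg_class u)^-1.
Proof. by rewrite -fg_invE. Qed.

End FreeGroup.

Definition letter_value (X : Type) (H : groupType) (f : X -> H) (d : X * bool) : H :=
  if d.2 then f d.1 else ((f d.1)^-1)%g.

Definition word_value (X : Type) (H : groupType) (f : X -> H)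
  (w : seq (X * bool)) : H := (\prod_(d <- w) letter_value f d)%g.

Definition fg_lift (X : choiceType) (H : groupType) (f : X -> H)
  (x : free_group X) : H := word_value f (repr x).

Section FreeGroupLift.
Local Open Scope group_scope.

Lemma letter_valueV (X : Type) (H : groupType) (f : X -> H) d :
  letter_value f (inv_letter d) = (letter_value f d)^-1.
Proof. by case: d => x []; rewrite /letter_value /= ?invgK. Qed.

Lemma word_value_cat (X : Type) (H : groupType) (f : X -> H) u v :
  word_value f (u ++ v) = word_value f u * word_value f v.
Proof. exact: big_cat. Qed.

Variables (X : choiceType) (H : groupType) (f : X -> H).

Lemma fg_lift_class w : fg_lift f (fg_class w) = word_value f w.
Proof.
apply: rst_quot_lift => _ _ [p [d [q [-> ->]]]].
rewrite !word_value_cat; congr (_ * _).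
by rewrite /word_value !big_cons letter_valueV mulgA mulgV mul1g.
Qed.

Lemma fg_lift_gen x : fg_lift f (fg_gen x) = f x.
Proof. by rewrite fg_lift_class /word_value big_seq1. Qed.

Fact fg_lift_morphism : monoid.monoid_morphism (fg_lift f).
Proof.
split=> [|x y]; first by rewrite [1]/(fg_class [::]) fg_lift_class /word_value big_nil.
rewrite -[x]fg_classK -[y]fg_classK -fg_classM !fg_lift_class.
exact: word_value_cat.
Qed.

HB.instance Definition _ :=
  isUMagmaMorphism.Build (free_group X) H (fg_lift f) fg_lift_morphism.

End FreeGroupLift.

Section GroupAlgebra.
Local Open Scope ring_scope.
Variables (k : fieldType) (Gam : groupType).

Definition group_algebra : Type := {malg k[Gam]}.

HB.instance Definition _ := GRing.Lmodule.on group_algebra.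

Implicit Types a b : group_algebra.

Definition ga (g : Gam) : group_algebra := << 1 *g g >>.

Definition linext (V : lmodType k) (h : Gam -> V) a : V :=
  \sum_(g <- msupp a) a@_g *: h g.

Lemma linextEw (V : lmodType k) (h : Gam -> V) (S : {fset Gam}) a :
  (msupp a `<=` S)%fset -> linext h a = \sum_(g <- S) a@_g *: h g.
Proof.
move=> sub; rewrite /linext; apply: big_fset_incl => // g _ /mcoeff_outdom ->.
by rewrite scale0r.
Qed.

Fact linext_is_linear (V : lmodType k) (h : Gam -> V) : linear (linext h).
Proof.
move=> c a b; pose S := (msupp a `|` msupp b `|` msupp (c *: a + b))%fset.
rewrite !(@linextEw V h S) /S ?fsubsetUr//.
- rewrite scaler_sumr -big_split /=; apply: eq_bigr => g _.
  by rewrite mcoeffD mcoeffZ scalerDl scalerA.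
- by rewrite -fsetUA fsubsetU// fsubsetUl orbT.
- by rewrite -fsetUA fsubsetU// fsubset_refl.
Qed.

HB.instance Definition _ (V : lmodType k) (h : Gam -> V) :=
  GRing.isLinear.Build k group_algebra V *:%R (linext h) (linext_is_linear h).

Lemma linext_ga (V : lmodType k) (h : Gam -> V) g : linext h (ga g) = h g.
Proof. by rewrite (linextEw _ msuppU_le) big_seq_fset1 mcoeffUU scale1r. Qed.

Lemma gaE a : a = \sum_(g <- msupp a) a@_g *: ga g.
Proof.
rewrite [LHS]monalgE; apply: eq_bigr => g _; apply/malgP => h.
by rewrite mcoeffZ !mcoeffU mulrnAr mulr1.
Qed.

Lemma ga_ext (V : lmodType k) (f f' : {linear group_algebra -> V}) :
  (forall g, f (ga g) = f' (ga g)) -> f =1 f'.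
Proof.
move=> ff' a; rewrite [a]gaE !linear_sum; apply: eq_bigr => g _.
by rewrite !linearZ_LR ff'.
Qed.

Definition ga_mul a b : group_algebra :=
  linext (fun g => linext (fun h => ga (g * h)%g) b) a.

Lemma ga_mul_ga g h : ga_mul (ga g) (ga h) = ga (g * h)%g.
Proof. by rewrite /ga_mul !linext_ga. Qed.

Fact ga_mul_linearl b : linear (ga_mul^~ b).
Proof. by move=> c a a'; rewrite /ga_mul linearP. Qed.

Fact ga_mul_linearr a : linear (ga_mul a).
Proof.
move=> c b b'; rewrite /ga_mul /linext scaler_sumr -big_split /=.
apply: eq_bigr => g _.
by have := linext_is_linear (fun h => ga (g * h)%g) c b b'; rewrite /linext => ->;
  rewrite scalerDr !scalerA mulrC.
Qed.

Definition ga_mull b : group_algebra -> group_algebra := ga_mul^~ b.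
Definition ga_mulr a : group_algebra -> group_algebra := ga_mul a.

HB.instance Definition _ b := GRing.isLinear.Build k group_algebra group_algebra
  *:%R (ga_mull b) (ga_mul_linearl b).
HB.instance Definition _ a := GRing.isLinear.Build k group_algebra group_algebra
  *:%R (ga_mulr a) (ga_mul_linearr a).

Fact ga_mulA : associative ga_mul.
Proof.
have gg_c g h c : ga_mul (ga g) (ga_mul (ga h) c) = ga_mul (ga_mul (ga g) (ga h)) c.
  rewrite ga_mul_ga.
  apply: (@ga_ext _ (ga_mulr (ga g) \o ga_mulr (ga h)) (ga_mulr (ga (g * h)%g))).
  by move=> i /=; rewrite /ga_mulr !ga_mul_ga mulgA.
have g_b_c g b c : ga_mul (ga g) (ga_mul b c) = ga_mul (ga_mul (ga g) b) c.
  apply: (@ga_ext _ (ga_mulr (ga g) \o ga_mull c) (ga_mull c \o ga_mulr (ga g))).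
  by move=> h /=; exact: gg_c.
move=> a b c.
apply: (@ga_ext _ (ga_mull (ga_mul b c)) (ga_mull c \o ga_mull b)).
by move=> g /=; exact: g_b_c.
Qed.

Fact ga_mul1 : left_id (ga 1%g) ga_mul.
Proof.
apply: (@ga_ext _ (ga_mulr (ga 1%g)) idfun) => g.
by rewrite /= /ga_mulr ga_mul_ga mul1g.
Qed.

Fact ga_1mul : right_id (ga 1%g) ga_mul.
Proof.
apply: (@ga_ext _ (ga_mull (ga 1%g)) idfun) => g.
by rewrite /= /ga_mull ga_mul_ga mulg1.
Qed.

Fact ga_mulDl : left_distributive ga_mul +%R.
Proof. by move=> a a' b; exact: (linearD (ga_mull b)). Qed.

Fact ga_mulDr : right_distributive ga_mul +%R.
Proof. by move=> a b b'; exact: (linearD (ga_mulr a)). Qed.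

Fact ga1_neq0 : ga 1%g != 0.
Proof. by rewrite monalgU_eq0 oner_eq0. Qed.

HB.instance Definition _ := GRing.Zmodule_isNzRing.Build group_algebra
  ga_mulA ga_mul1 ga_1mul ga_mulDl ga_mulDr ga1_neq0.

Fact ga_scalerAl (c : k) a b : c *: (a * b) = (c *: a) * b.
Proof. by rewrite [RHS](linearZ_LR (ga_mull b)). Qed.

HB.instance Definition _ :=
  GRing.Lmodule_isLalgebra.Build k group_algebra ga_scalerAl.

Fact ga_scalerAr (c : k) a b : c *: (a * b) = a * (c *: b).
Proof. by rewrite [RHS](linearZ_LR (ga_mulr a)). Qed.

HB.instance Definition _ :=
  GRing.Lalgebra_isAlgebra.Build k group_algebra ga_scalerAr.

Lemma gaM g h : ga (g * h)%g = ga g * ga h.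
Proof. by rewrite -ga_mul_ga. Qed.

Lemma ga1 : ga 1%g = 1. Proof. by []. Qed.

Lemma linext_monoid_morphism (A : algType k) (h : Gam -> A) :
  h 1%g = 1 -> {morph h : g g' / (g * g')%g >-> g * g'} ->
  monoid_morphism (linext h).
Proof.
move=> h1 hM; split=> [|a b]; first by rewrite -ga1 linext_ga.
have g_b g c : linext h (ga g * c) = h g * linext h c.
  apply: (@ga_ext _ (linext h \o ga_mulr (ga g)) (h g \*o linext h)).
  by move=> g' /=; rewrite /ga_mulr ga_mul_ga !linext_ga.
apply: (@ga_ext _ (linext h \o ga_mull b) (linext h b \o* linext h)) => g /=.
by rewrite linext_ga -g_b.
Qed.

Definition aug a : k := \sum_(g <- msupp a) a@_g.

Lemma augE a : aug a = linext (fun=> 1 : k^o) a.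
Proof. by apply: eq_bigr => g _; rewrite [RHS]mulr1. Qed.

Lemma aug_ga g : aug (ga g) = 1.
Proof. by rewrite augE linext_ga. Qed.

Fact aug_is_linear : scalar aug.
Proof. by move=> c a b; rewrite !augE linearP. Qed.

Fact aug_monoid_morphism : monoid_morphism aug.
Proof.
have [|m1 mM] := @linext_monoid_morphism k^o (fun=> 1) erefl.
  by move=> g g'; rewrite mulr1.
by split=> [|a b]; rewrite !augE ?m1 ?mM.
Qed.

HB.instance Definition _ :=
  GRing.isLinear.Build k group_algebra k *%R aug aug_is_linear.
HB.instance Definition _ :=
  GRing.isMonoidMorphism.Build group_algebra k aug aug_monoid_morphism.

End GroupAlgebra.

Section IdealPowers.
Local Open Scope ring_scope.
Local Open Scope classical_set_scope.
Variable A : nzRingType.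

Definition ideal_mul (I J : set A) : set A :=
  [set x | exists2 s : seq (A * A),
     (forall p, p \in s -> I p.1 /\ J p.2) & x = \sum_(p <- s) p.1 * p.2].

Fixpoint ideal_pow (I : set A) (n : nat) : set A :=
  if n is m.+1 then ideal_mul I (ideal_pow I m) else setT.

Lemma ideal_mul0 I J : ideal_mul I J 0.
Proof. by exists [::] => //; rewrite big_nil. Qed.

Lemma ideal_mulD I J x y :
  ideal_mul I J x -> ideal_mul I J y -> ideal_mul I J (x + y).
Proof.
move=> [s sP ->] [t tP ->]; exists (s ++ t); last by rewrite big_cat.
by move=> p; rewrite mem_cat => /orP[/sP|/tP].
Qed.

Lemma ideal_mul_prod (I J : set A) x y : I x -> J y -> ideal_mul I J (x * y).
Proof.
move=> Ix Jy; exists [:: (x, y)]; last by rewrite big_seq1.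
by move=> p; rewrite inE => /eqP ->.
Qed.

Lemma ideal_mul_ind I J (P : A -> Prop) : P 0 ->
  (forall x y, P x -> P y -> P (x + y)) ->
  (forall x y, I x -> J y -> P (x * y)) ->
  forall x, ideal_mul I J x -> P x.
Proof.
move=> P0 PD PM _ [s sP ->]; rewrite big_seq; elim/big_ind: _ => //= p /sP[].
exact: PM.
Qed.

End IdealPowers.

Definition aug_ideal (k : fieldType) (Gam : groupType) :
  set (group_algebra k Gam) := [set a | aug a = 0%R]%classic.

Definition aug_pow (k : fieldType) (Gam : groupType) (n : nat) :
  {pred group_algebra k Gam} := fun a => `[< ideal_pow (@aug_ideal k Gam) n a >].

Section AugPow.
Local Open Scope ring_scope.
Variables (k : fieldType) (Gam : groupType).
Implicit Types a b : group_algebra k Gam.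

Lemma aug_pow_mull n a b : b \in aug_pow n -> a * b \in aug_pow n.
Proof.
case: n => [_|n /asboolP bJ]; first exact/asboolP.
apply/asboolP; elim/ideal_mul_ind: b / bJ => [|x y|x y Jx Jy].
- by rewrite mulr0; exact: ideal_mul0.
- by rewrite mulrDr; exact: ideal_mulD.
- rewrite mulrA; apply: ideal_mul_prod => //.
  by rewrite /aug_ideal /= rmorphM /= Jx mulr0.
Qed.

Lemma aug_pow_mulr n a b : a \in aug_pow n -> a * b \in aug_pow n.
Proof.
move=> /asboolP aJ; apply/asboolP; elim: n a aJ b => [//|n IHn] a aJ b.
elim/ideal_mul_ind: a / aJ => [|x y|x y Jx Jy].
- by rewrite mul0r; exact: ideal_mul0.
- by rewrite mulrDl; exact: ideal_mulD.
- by rewrite -mulrA; apply: ideal_mul_prod => //; exact: IHn.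
Qed.

Fact aug_pow_zmod_closed n : zmod_closed (@aug_pow k Gam n).
Proof.
split=> [|a b aJ bJ].
  by apply/asboolP; case: n => //= n; exact: ideal_mul0.
have {bJ}/asboolP bJ : - b \in aug_pow n by rewrite -mulN1r aug_pow_mull.
by move/asboolP: aJ => aJ; apply/asboolP; case: n aJ bJ => // n; exact: ideal_mulD.
Qed.

HB.instance Definition _ n := GRing.isZmodClosed.Build (group_algebra k Gam)
  (@aug_pow k Gam n) (aug_pow_zmod_closed n).

Lemma aug_pow_aug n a : a \in aug_pow n.+1 -> aug a = 0.
Proof.
move=> /asboolP aJ; elim/ideal_mul_ind: a / aJ => [|x y|x y Jx _].
- exact: raddf0.
- by rewrite raddfD /= => -> ->; rewrite addr0.
- by rewrite rmorphM /= Jx mul0r.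
Qed.

End AugPow.

(** The [n]-truncation divides by the power [n.+1] of the augmentation ideal. *)
Definition truncation (k : fieldType) (Gam : groupType) (n : nat) : Type :=
  {ideal_quot @aug_pow k Gam n.+1}.

Section Truncation.
Local Open Scope ring_scope.
Local Open Scope quotient_scope.
Variables (k : fieldType) (Gam : groupType) (n : nat).
Local Notation A := (group_algebra k Gam).
Local Notation T := (truncation k Gam n).

HB.instance Definition _ := GRing.Zmodule.on T.

Definition tr (a : A) : T := \pi_{ideal_quot @aug_pow k Gam n.+1} a.

Lemma trP a b : tr a = tr b <-> a - b \in aug_pow n.+1.
Proof. by rewrite Quotient.idealrBE; split=> /eqP. Qed.

Lemma trK (x : T) : tr (repr x) = x. Proof. exact: reprK. Qed.

Lemma tr_repr a : repr (tr a) - a \in aug_pow n.+1.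
Proof. by apply/trP; rewrite trK. Qed.

Fact tr_zmod_morphism : zmod_morphism tr.
Proof. by move=> a b; rewrite /tr !piE. Qed.

HB.instance Definition _ := GRing.isZmodMorphism.Build A T tr tr_zmod_morphism.

Definition tr_mul (x y : T) : T := tr (repr x * repr y).
Definition tr_scale (c : k) (x : T) : T := tr (c *: repr x).

Lemma tr_mulE a b : tr_mul (tr a) (tr b) = tr (a * b).
Proof.
apply/trP; set a' := repr _; set b' := repr _.
have -> : a' * b' - a * b = (a' - a) * b' + a * (b' - b).
  by rewrite mulrBl mulrBr addrA subrK.
by apply: rpredD; [apply: aug_pow_mulr | apply: aug_pow_mull]; exact: tr_repr.
Qed.

Lemma tr_scaleE c a : tr_scale c (tr a) = tr (c *: a).
Proof. by apply/trP; rewrite -scalerBr -mulr_algl aug_pow_mull// tr_repr. Qed.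

Fact tr_mulA : associative tr_mul.
Proof. by move=> x y z; rewrite -[x]trK -[y]trK -[z]trK !tr_mulE mulrA. Qed.

Fact tr_mul1 : left_id (tr 1) tr_mul.
Proof. by move=> x; rewrite -[x]trK tr_mulE mul1r. Qed.

Fact tr_1mul : right_id (tr 1) tr_mul.
Proof. by move=> x; rewrite -[x]trK tr_mulE mulr1. Qed.

Fact tr_mulDl : left_distributive tr_mul +%R.
Proof.
move=> x y z; rewrite -[x]trK -[y]trK -[z]trK -raddfD !tr_mulE -raddfD.
by rewrite mulrDl.
Qed.

Fact tr_mulDr : right_distributive tr_mul +%R.
Proof.
move=> x y z; rewrite -[x]trK -[y]trK -[z]trK -raddfD !tr_mulE -raddfD.
by rewrite mulrDr.
Qed.

Fact tr1_neq0 : tr 1 != 0.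
Proof.
apply/eqP; rewrite -(raddf0 tr) => /trP; rewrite subr0 => /aug_pow_aug /eqP.
by rewrite rmorph1 oner_eq0.
Qed.

HB.instance Definition _ := GRing.Zmodule_isNzRing.Build T
  tr_mulA tr_mul1 tr_1mul tr_mulDl tr_mulDr tr1_neq0.

Fact tr_scalerA c d x : tr_scale c (tr_scale d x) = tr_scale (c * d) x.
Proof. by rewrite -[x]trK !tr_scaleE scalerA. Qed.

Fact tr_scale1r : left_id 1 tr_scale.
Proof. by move=> x; rewrite -[x]trK tr_scaleE scale1r. Qed.

Fact tr_scalerDr : right_distributive tr_scale +%R.
Proof.
by move=> c x y; rewrite -[x]trK -[y]trK -raddfD !tr_scaleE -raddfD scalerDr.
Qed.

Fact tr_scalerDl x : {morph tr_scale^~ x : c d / c + d}.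
Proof. by move=> c d; rewrite -[x]trK !tr_scaleE -raddfD scalerDl. Qed.

HB.instance Definition _ := GRing.Zmodule_isLmodule.Build k T
  tr_scalerA tr_scale1r tr_scalerDr tr_scalerDl.

Lemma trM a b : tr (a * b) = tr a * tr b.
Proof. by rewrite -tr_mulE. Qed.

Lemma trZ c a : tr (c *: a) = c *: tr a.
Proof. by rewrite -tr_scaleE. Qed.

Fact tr_scalerAl (c : k) (x y : T) : c *: (x * y) = (c *: x) * y.
Proof.
rewrite -[x]trK -[y]trK; move: (repr x) (repr y) => a b.
transitivity (tr (c *: (a * b))); first by rewrite trZ trM.
by rewrite scalerAl trM trZ.
Qed.

HB.instance Definition _ := GRing.Lmodule_isLalgebra.Build k T tr_scalerAl.

Fact tr_scalerAr (c : k) (x y : T) : c *: (x * y) = x * (c *: y).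
Proof.
rewrite -[x]trK -[y]trK; move: (repr x) (repr y) => a b.
transitivity (tr (c *: (a * b))); first by rewrite trZ trM.
by rewrite scalerAr trM trZ.
Qed.

HB.instance Definition _ := GRing.Lalgebra_isAlgebra.Build k T tr_scalerAr.

Fact tr_monoid_morphism : monoid_morphism tr.
Proof. by split=> // a b; rewrite trM. Qed.

HB.instance Definition _ := GRing.isMonoidMorphism.Build A T tr tr_monoid_morphism.
HB.instance Definition _ := GRing.isScalable.Build k A T *:%R tr trZ.

End Truncation.

Section InducedMaps.
Local Open Scope ring_scope.
Local Open Scope quotient_scope.
Variables (k : fieldType) (Gam Gam' : groupType).
Variable f : UMagmaMorphism.type Gam Gam'.

Definition ga_map : group_algebra k Gam -> group_algebra k Gam' :=
  linext (fun g => ga k (f g)).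

HB.instance Definition _ := GRing.Linear.on ga_map.

Lemma ga_map_ga g : ga_map (ga k g) = ga k (f g).
Proof. exact: linext_ga. Qed.

Fact ga_map_monoid_morphism : monoid_morphism ga_map.
Proof.
apply: linext_monoid_morphism => [|g h]; first by rewrite gmulf1.
by rewrite gmulfM gaM.
Qed.

HB.instance Definition _ := GRing.isMonoidMorphism.Build
  (group_algebra k Gam) (group_algebra k Gam') ga_map ga_map_monoid_morphism.

Lemma aug_ga_map a : aug (ga_map a) = aug a.
Proof.
rewrite !augE.
apply: (@ga_ext _ _ _ (linext (fun=> 1 : k^o) \o ga_map) (linext (fun=> 1))) => g.
by rewrite /= ga_map_ga !linext_ga.
Qed.

Lemma ga_map_aug_pow n a : a \in aug_pow n -> ga_map a \in aug_pow n.
Proof.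
move=> /asboolP aJ; apply/asboolP; elim: n a aJ => [//|n IHn] a aJ.
elim/ideal_mul_ind: a / aJ => [|x y|x y Jx Jy].
- by rewrite raddf0; exact: ideal_mul0.
- by rewrite raddfD; exact: ideal_mulD.
- rewrite rmorphM; apply: ideal_mul_prod; last exact: IHn.
  by rewrite /aug_ideal /= aug_ga_map.
Qed.

Variable n : nat.

Definition truncation_map (x : truncation k Gam n) : truncation k Gam' n :=
  tr n (ga_map (repr x)).

Lemma truncation_mapE a : truncation_map (tr n a) = tr n (ga_map a).
Proof. by apply/trP; rewrite -raddfB; apply: ga_map_aug_pow; exact: tr_repr. Qed.

Fact truncation_map_linear : linear truncation_map.
Proof.
move=> c x y; rewrite -[x]trK -[y]trK -linearP !truncation_mapE.
by rewrite -linearP -linearP.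
Qed.

Fact truncation_map_monoid_morphism : monoid_morphism truncation_map.
Proof.
split=> [|x y]; first by rewrite -(rmorph1 (tr n)) truncation_mapE !rmorph1.
by rewrite -[x]trK -[y]trK -rmorphM !truncation_mapE -!rmorphM.
Qed.

HB.instance Definition _ := GRing.isLinear.Build k
  (truncation k Gam n) (truncation k Gam' n) *:%R
  truncation_map truncation_map_linear.
HB.instance Definition _ := GRing.isMonoidMorphism.Build
  (truncation k Gam n) (truncation k Gam' n)
  truncation_map truncation_map_monoid_morphism.

End InducedMaps.

Arguments truncation_map k {Gam Gam'} f n x.

(** [ends e false] and [ends e true] are the endpoints of [e], in an order that
    carries no meaning: reference orientations are chosen separately below. *)
Record graph := Graph {
  vertex : finType;
  edge : finType;
  ends : edge -> bool -> vertex
}.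

(** The oriented edge [(e, b)] goes from [ends e b] to [ends e (~~ b)], and
    [inv_letter] reverses it. *)
Definition dart (G : graph) : Type := (edge G * bool)%type.

HB.instance Definition _ (G : graph) := Finite.on (dart G).

Section Graphs.
Variable G : graph.

Definition dart_src (d : dart G) : vertex G := ends d.1 d.2.
Definition dart_tgt (d : dart G) : vertex G := ends d.1 (~~ d.2).
Definition dart_rev (d : dart G) : dart G := inv_letter d.

Definition adj : rel (vertex G) :=
  [rel x y | [exists d : dart G, (dart_src d == x) && (dart_tgt d == y)]].

Definition n_components : nat := n_comp adj predT.

Definition connected_graph : bool := n_components == 1.

Definition del_edge (e : edge G) : graph :=
  @Graph (vertex G) {e' : edge G | e' != e} (fun e' => ends (val e')).

End Graphs.

Definition cut_edge (G : graph) (e : edge G) : bool :=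
  n_components G < n_components (del_edge e).

Definition two_edge_connected (G : graph) : bool :=
  connected_graph G && [forall e : edge G, ~~ cut_edge e].

Fixpoint is_walk (G : graph) (x : vertex G) (p : seq (dart G)) (y : vertex G) :
    bool :=
  if p is d :: q then (dart_src d == x) && is_walk (dart_tgt d) q y else x == y.

Record closed_walk (G : graph) (v : vertex G) := ClosedWalk {
  walk_darts :> seq (dart G);
  closed_walkP : is_walk v walk_darts v
}.

HB.instance Definition _ (G : graph) (v : vertex G) :=
  [isSub for @walk_darts G v].
HB.instance Definition _ (G : graph) (v : vertex G) :=
  [Choice of closed_walk v by <:].

(** Homotopy of closed walks relative to the base point is generated by the
    insertion and deletion of backtracks. *)
Definition backtracks (G : graph) (v : vertex G) (p q : closed_walk v) : Prop :=
  cancels (walk_darts p) (walk_darts q).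

Definition pi1 (G : graph) (v : vertex G) : Type := rst_quot (@backtracks G v).

Section FundamentalGroup.
Local Open Scope quotient_scope.
Variables (G : graph) (v : vertex G).

HB.instance Definition _ := Choice.on (pi1 v).

Lemma is_walk_cat (x y z : vertex G) p q :
  is_walk x p y -> is_walk y q z -> is_walk x (p ++ q) z.
Proof.
elim: p x => [x /eqP -> //|d p IHp x /= /andP[-> /IHp yz]]; exact: yz.
Qed.

Lemma is_walk_inv (x y : vertex G) p : is_walk x p y -> is_walk y (inv_word p) x.
Proof.
elim: p x => [x /eqP ->|d p IHp x /= /andP[/eqP <- /IHp yd]] /=.
  by rewrite eqxx.
rewrite inv_word_cons; apply: is_walk_cat yd _.
by rewrite /= /dart_src /dart_tgt /= negbK !eqxx.
Qed.

Definition walk1 : closed_walk v := @ClosedWalk G v [::] (eqxx v).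
Definition walkV (p : closed_walk v) : closed_walk v :=
  ClosedWalk (is_walk_inv (closed_walkP p)).
Definition walkM (p q : closed_walk v) : closed_walk v :=
  ClosedWalk (is_walk_cat (closed_walkP p) (closed_walkP q)).

Definition pi1_class (p : closed_walk v) : pi1 v := \pi_(rst_quot (@backtracks G v)) p.

Lemma pi1_classP p q :
  pi1_class p = pi1_class q <-> clos_refl_sym_trans _ (@backtracks G v) p q.
Proof. exact: rst_quotP. Qed.

Lemma pi1_class_backtracks p q : backtracks p q -> pi1_class p = pi1_class q.
Proof. by move=> pq; apply/pi1_classP/rst_step. Qed.

Lemma pi1_classK (x : pi1 v) : pi1_class (repr x) = x.
Proof. exact: reprK. Qed.

Definition pi1_one : pi1 v := pi1_class walk1.
Definition pi1_inv (x : pi1 v) : pi1 v := pi1_class (walkV (repr x)).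
Definition pi1_mul (x y : pi1 v) : pi1 v := pi1_class (walkM (repr x) (repr y)).

Lemma pi1_mulE p q : pi1_mul (pi1_class p) (pi1_class q) = pi1_class (walkM p q).
Proof.
rewrite /pi1_mul.
transitivity (pi1_class (walkM p (repr (pi1_class q)))).
  apply: (@rst_quot_lift _ _ _ (fun w => pi1_class (walkM w _))) => {}p w pw.
  exact/pi1_class_backtracks/cancels_catr.
apply: (@rst_quot_lift _ _ _ (fun w => pi1_class (walkM p w))) => {}q w qw.
exact/pi1_class_backtracks/cancels_catl.
Qed.

Lemma pi1_invE p : pi1_inv (pi1_class p) = pi1_class (walkV p).
Proof.
apply: (@rst_quot_lift _ _ _ (fun w => pi1_class (walkV w))) => {}p w pw.
exact/pi1_class_backtracks/cancels_inv.
Qed.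

Fact pi1_mulA : associative pi1_mul.
Proof.
move=> x y z; rewrite -[x]pi1_classK -[y]pi1_classK -[z]pi1_classK !pi1_mulE.
by congr pi1_class; apply: val_inj; rewrite /= catA.
Qed.

Fact pi1_mul1g : left_id pi1_one pi1_mul.
Proof.
move=> x; rewrite -[x]pi1_classK pi1_mulE.
by congr pi1_class; apply: val_inj.
Qed.

Fact pi1_mulg1 : right_id pi1_one pi1_mul.
Proof.
move=> x; rewrite -[x]pi1_classK pi1_mulE.
by congr pi1_class; apply: val_inj; rewrite /= cats0.
Qed.

Lemma pi1_class_mulgV p : pi1_class (walkM p (walkV p)) = pi1_one.
Proof.
suff H (w : seq (dart G)) x (r : closed_walk v) : is_walk v w x ->
    walk_darts r = w ++ inv_word w -> pi1_class r = pi1_one.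
  by apply: H (closed_walkP p) _.
elim/last_ind: w x r => [x r _ rE|w d IHw x r].
  by congr pi1_class; apply: val_inj.
have splitw (y z : vertex G) u u' : is_walk y (u ++ u') z ->
    exists2 t, is_walk y u t & is_walk t u' z.
  elim: u y => [y yz|c u IHu y /= /andP[-> /IHu]] //=.
  by exists y; rewrite /= ?eqxx.
rewrite -cats1 => /splitw[t wt _] rE.
rewrite -(IHw t (ClosedWalk (is_walk_cat wt (is_walk_inv wt))))//.
apply: pi1_class_backtracks; exists w, d, (inv_word w).
by rewrite rE inv_word_cat -!catA.
Qed.

Fact pi1_mulgV : right_inverse pi1_one pi1_inv pi1_mul.
Proof.
by move=> x; rewrite -[x]pi1_classK pi1_invE pi1_mulE pi1_class_mulgV.
Qed.

Fact pi1_mulVg : left_inverse pi1_one pi1_inv pi1_mul.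
Proof.
move=> x; rewrite -[x]pi1_classK pi1_invE pi1_mulE.
rewrite -[RHS](pi1_class_mulgV (walkV (repr x))).
by congr pi1_class; apply: val_inj; rewrite /= inv_wordK.
Qed.

HB.instance Definition _ := isGroup.Build (pi1 v)
  pi1_mulA pi1_mul1g pi1_mulg1 pi1_mulVg pi1_mulgV.

Lemma pi1_classM p q : pi1_class (walkM p q) = (pi1_class p * pi1_class q)%g.
Proof. by rewrite -pi1_mulE. Qed.

End FundamentalGroup.

(** The chosen orientation of [e] is the oriented edge [(e, o e)]. The boolean of
    a dart is not the sign of a letter of [free_group (edge G)]: the comparison
    with [o] in [dart_elt] relates the two. *)
Definition orientation (G : graph) : Type := edge G -> bool.

Definition dart_elt (G : graph) (o : orientation G) (d : dart G) :
    free_group (edge G) :=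
  (if d.2 == o d.1 then fg_gen d.1 else (fg_gen d.1)^-1)%g.

Definition edge_word (G : graph) (o : orientation G) (v : vertex G) (x : pi1 v) :
    free_group (edge G) :=
  (\prod_(d <- walk_darts (repr x)) dart_elt o d)%g.

Section EdgeWord.
Local Open Scope group_scope.
Variables (G : graph) (o : orientation G) (v : vertex G).

Lemma dart_elt_rev d : dart_elt o (dart_rev d) = (dart_elt o d)^-1.
Proof.
by case: d => e b; rewrite /dart_elt /=; case: b; case: (o e); rewrite /= ?invgK.
Qed.

Lemma edge_word_class (p : closed_walk v) :
  edge_word o (pi1_class p) = \prod_(d <- walk_darts p) dart_elt o d.
Proof.
apply: (@rst_quot_lift _ _ _ (fun w : closed_walk v => \prod_(d <- w) dart_elt o d)).
move=> r s [p1 [d [q [-> ->]]]].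
by rewrite !big_cat !big_cons /= -/(dart_rev d) dart_elt_rev mulVKg.
Qed.

Fact edge_word_morphism : monoid.monoid_morphism (@edge_word G o v).
Proof.
split=> [|x y]; first by rewrite [1]/(pi1_class _) edge_word_class big_nil.
by rewrite -[x]pi1_classK -[y]pi1_classK -pi1_classM !edge_word_class big_cat.
Qed.

HB.instance Definition _ := isUMagmaMorphism.Build (pi1 v) (free_group (edge G))
  (@edge_word G o v) edge_word_morphism.

End EdgeWord.

Arguments edge_word {G} o v x.

Definition dart_bijection (G G' : graph) (phi : dart G -> dart G') : Prop :=
  bijective phi /\ forall d, phi (dart_rev d) = dart_rev (phi d).

Definition dart_hom (G G' : graph) (o : orientation G) (o' : orientation G')
    (phi : dart G -> dart G') : free_group (edge G) -> free_group (edge G') :=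
  fg_lift (fun e => dart_elt o' (phi (e, o e))).

HB.instance Definition _ G G' o o' phi :=
  UMagmaMorphism.on (@dart_hom G G' o o' phi).

Definition graph_iso_at (G G' : graph) (phi : dart G -> dart G')
    (v0 : vertex G) (v0' : vertex G') : Prop :=
  exists phiV : vertex G -> vertex G',
    [/\ bijective phiV,
        forall d, dart_src (phi d) = phiV (dart_src d) /\
                  dart_tgt (phi d) = phiV (dart_tgt d)
      & phiV v0 = v0'].

(* Main.v *)
Require Import Defs.
From HB Require Import structures.
From mathcomp Require Import all_boot all_algebra.
From mathcomp Require Import boolp classical_sets.
From mathcomp Require Import ring.

(** The dual of [k[F]/J^3] consists of the functions on the free group [F] that
    are polynomial of degree at most 2: iterated integrals [int alpha beta] of
    pairs of cochains, corrected by linear terms. The proof tests the hypothesis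
    against the ones for which [alpha] is a coboundary [df].

    Such an integral is the corner coordinate of a homomorphism from [F] to the
    Heisenberg group, and every corner coordinate kills [J^3]
    ([heis_c_aug_pow]). Let [f] be a function on the vertices of [G'] and [b] an
    antisymmetric function of its darts, and send the dart [d] to

      [(f (tgt d) - f (src d), b d, - (f (src d) - f v0') * b d)].

    The corner term is chosen so that a walk from [x] to [y] is sent to
    [(f y - f x, B, - (f x - f v0') * B)], where [B] sums [b] over the walk
    ([heis_gauge_walk]); hence the corner coordinate vanishes on closed walks at
    [v0'], thus on the image of [k[pi1(G', v0')]]. If [phi] carries the image of
    [k[pi1(G, v0)]] into it, the corner coordinate of the homomorphism pulled
    back along [phi] vanishes on closed walks of [G] at [v0]
    ([heis_transfer]).

    Take for [b] the signed indicator of [phi d], for one dart [d] of [G]. The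
    edge of [d] is not a bridge, so some closed walk at [v0] crosses it exactly
    once, along [d]. The corner coordinate of that walk is the sum of
    [df (phi c)] over the part preceding [d], minus [f (src (phi d)) - f v0'].
    That sum depends only on the endpoint [src d], because the linear part of
    the hypothesis makes [df o phi] vanish on closed walks. Therefore
    [f (src (phi d))] is a function of [src d] for every [f] ([src_phi]), and so
    is [src (phi d)] itself: [phi] induces a map of vertices preserving base
    points ([vertex_map]). This uses only the inclusion of one image in the
    other. The opposite inclusion gives a vertex map for the inverse of [phi],
    and the two are mutually inverse because a vertex other than the base point
    is the source of some dart. *)

Set Implicit Arguments.
Unset Strict Implicit.
Unset Printing Implicit Defensive.

Import GRing.Theory.

Local Open Scope classical_set_scope.

(** * Linear and quadratic functions on powers of the augmentation ideal *)

Section LinearExtension.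
Local Open Scope ring_scope.
Variables (k : fieldType) (Gam : groupType).
Implicit Types s t : group_algebra k Gam.

Lemma linextM (V : lmodType k) (h : Gam -> V) s t :
  linext h (s * t) = linext (fun g => linext (fun g' => h (g * g')%g) t) s.
Proof.
have gaM_t g : linext h (ga k g * t) = linext (fun g' => h (g * g')%g) t.
  apply: (@ga_ext _ _ _ (linext h \o ga_mulr (ga k g))
    (linext (fun g' => h (g * g')%g))) => g' /=.
  by rewrite /ga_mulr ga_mul_ga !linext_ga.
apply: (@ga_ext _ _ _ (linext h \o ga_mull t)
  (linext (fun g => linext (fun g' => h (g * g')%g) t))) => g /=.
by rewrite [ga_mull t _]/(ga k g * t) gaM_t linext_ga.
Qed.

Lemma linext_ga_map (Gam' : groupType) (f : UMagmaMorphism.type Gam' Gam)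
    (V : lmodType k) (h : Gam -> V) (s : group_algebra k Gam') :
  linext h (ga_map f s) = linext (h \o f) s.
Proof.
apply: (@ga_ext _ _ _ (linext h \o ga_map f) (linext (h \o f))) => g.
by rewrite /= ga_map_ga !linext_ga.
Qed.

Lemma linext0 s (h : Gam -> k^o) : (forall g, h g = 0) -> linext h s = 0.
Proof. by move=> h0; rewrite /linext big1// => g _; rewrite h0 scaler0. Qed.

Lemma linext_comb s (h1 h2 h : Gam -> k^o) (c1 c2 : k) :
  (forall g, h g = c1 * h1 g + c2 * h2 g) ->
  linext h s = c1 * linext h1 s + c2 * linext h2 s.
Proof.
move=> hE; rewrite /linext !mulr_sumr -big_split /=; apply: eq_bigr => g _.
by rewrite hE scalerDr !scalerAr.
Qed.

(** A Leibniz rule. With [a = 0] it covers additive functions [c]; otherwise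
    the cocycle relation on [c] is the multiplication of the corner entries of
    unitriangular 3 x 3 matrices. *)
Lemma linext_prod (a b c : Gam -> k^o) s t :
  (forall g h, c (g * h)%g = c g + c h + a g * b h) ->
  linext c (s * t)
    = aug t * linext c s + aug s * linext c t + linext a s * linext b t.
Proof.
move=> cM; rewrite linextM.
rewrite (@linext_comb s (fun g => aug t * c g + linext b t * a g) (fun=> 1) _
  1 (linext c t)) => [|g].
  rewrite mul1r -augE (@linext_comb s c a _ (aug t) (linext b t))//.
  ring.
rewrite (@linext_comb t (fun h => c g + c h) b _ 1 (a g)) => [|h].
  rewrite (@linext_comb t (fun=> 1) c _ (c g) 1) => [|h].
    by rewrite -augE !mul1r mulr1 [c g * _]mulrC [a g * _]mulrC addrAC.
  by rewrite mulr1 mul1r.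
by rewrite cM mul1r.
Qed.

Lemma linext_additive_aug_pow (b : Gam -> k^o) s :
  (forall g h, b (g * h)%g = b g + b h) -> s \in aug_pow 2 -> linext b s = 0.
Proof.
move=> bM /asboolP sJ; elim/ideal_mul_ind: s / sJ => [|x y|x y Jx Jy].
- exact: raddf0.
- by rewrite raddfD /= => -> ->; rewrite addr0.
have {}Jy : aug y = 0 by apply: (@aug_pow_aug _ _ 0); apply/asboolP.
rewrite (@linext_prod (fun=> 0) (fun=> 0)) => [|g h]; last first.
  by rewrite bM mulr0 addr0.
by rewrite Jx Jy [linext (fun=> 0) x]linext0// !mul0r !addr0.
Qed.

(** On a product [x * y] with [x] in [J] and [y] in [J^2], each term of the
    Leibniz rule has a vanishing factor: [aug x], [aug y], or the additive
    function [b] evaluated at [y]. *)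
Lemma linext_quadratic_aug_pow (a b c : Gam -> k^o) s :
  (forall g h, b (g * h)%g = b g + b h) ->
  (forall g h, c (g * h)%g = c g + c h + a g * b h) ->
  s \in aug_pow 3 -> linext c s = 0.
Proof.
move=> bM cM /asboolP sJ; elim/ideal_mul_ind: s / sJ => [|x y|x y Jx Jy].
- exact: raddf0.
- by rewrite raddfD /= => -> ->; rewrite addr0.
have {}Jy : y \in aug_pow 2 by apply/asboolP.
rewrite (linext_prod _ _ cM) (linext_additive_aug_pow bM Jy) Jx.
by rewrite (@aug_pow_aug _ _ 1 _ Jy) !mul0r mulr0 !addr0.
Qed.

End LinearExtension.

(** * The Heisenberg group *)

Section Heisenberg.
Local Open Scope ring_scope.
Variable R : comNzRingType.

(** The triple [(a, b, c)] is the unitriangular 3 x 3 matrix with [a] and [b]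
    above the diagonal and [c] in the corner. *)
Definition heisenberg : Type := (R * R * R)%type.

HB.instance Definition _ := Choice.on heisenberg.

Implicit Types x y z : heisenberg.

Definition heis (a b c : R) : heisenberg := (a, b, c).
Definition heis_a x : R := x.1.1.
Definition heis_b x : R := x.1.2.
Definition heis_c x : R := x.2.

Definition heis_mul x y : heisenberg :=
  heis (heis_a x + heis_a y) (heis_b x + heis_b y)
       (heis_c x + heis_c y + heis_a x * heis_b y).

Definition heis_inv x : heisenberg :=
  heis (- heis_a x) (- heis_b x) (- heis_c x + heis_a x * heis_b x).

Fact heis_mulA : associative heis_mul.
Proof.
by move=> x y z; congr (_, _, _); rewrite /heis_a /heis_b /heis_c /=; ring.
Qed.

Fact heis_mul1 : left_id (heis 0 0 0) heis_mul.
Proof.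
by move=> [[a b] c]; congr (_, _, _); rewrite /heis_a /heis_b /heis_c /=; ring.
Qed.

Fact heis_1mul : right_id (heis 0 0 0) heis_mul.
Proof.
by move=> [[a b] c]; congr (_, _, _); rewrite /heis_a /heis_b /heis_c /=; ring.
Qed.

Fact heis_mulV : left_inverse (heis 0 0 0) heis_inv heis_mul.
Proof. by move=> x; congr (_, _, _); rewrite /heis_a /heis_b /heis_c /=; ring. Qed.

Fact heis_Vmul : right_inverse (heis 0 0 0) heis_inv heis_mul.
Proof. by move=> x; congr (_, _, _); rewrite /heis_a /heis_b /heis_c /=; ring. Qed.

HB.instance Definition _ := isGroup.Build heisenberg
  heis_mulA heis_mul1 heis_1mul heis_mulV heis_Vmul.

Lemma heisM a b c a' b' c' :
  (heis a b c * heis a' b' c')%g = heis (a + a') (b + b') (c + c' + a * b').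
Proof. by []. Qed.

Lemma heisV a b c : ((heis a b c)^-1)%g = heis (- a) (- b) (- c + a * b).
Proof. by []. Qed.

Lemma heis_prod_a (I : Type) (r : seq I) (a : I -> R) :
  (\prod_(i <- r) heis (a i) 0 0)%g = heis (\sum_(i <- r) a i) 0 0.
Proof.
elim: r => [|i r IHr]; first by rewrite !big_nil.
by rewrite !big_cons IHr heisM mulr0 !addr0.
Qed.

Lemma heis_prod_c (I : Type) (r : seq I) (c : I -> R) :
  (\prod_(i <- r) heis 0 0 (c i))%g = heis 0 0 (\sum_(i <- r) c i).
Proof.
elim: r => [|i r IHr]; first by rewrite !big_nil.
by rewrite !big_cons IHr heisM mulr0 !addr0.
Qed.

End Heisenberg.

Lemma heis_c_aug_pow (k : fieldType) (Gam : groupType)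
    (rho : UMagmaMorphism.type Gam (heisenberg k)) (s : group_algebra k Gam) :
  s \in aug_pow 3 ->
  linext (fun g => heis_c (rho g) : GRing.regular k) s = 0%R.
Proof.
apply: (@linext_quadratic_aug_pow k Gam (fun g => heis_a (rho g))
  (fun g => heis_b (rho g))) => g h; by rewrite gmulfM.
Qed.

(** * Homomorphisms on the free group of edges *)

Section FreeGroupMorphisms.
Local Open Scope group_scope.

Lemma fg_morphism_ext (X : choiceType) (H : groupType)
    (f f' : UMagmaMorphism.type (free_group X) H) :
  (forall x, f (fg_gen x) = f' (fg_gen x)) -> f =1 f'.
Proof.
move=> ff' x; rewrite -[x]fg_classK; elim: (repr x) => [|[e b] w IHw].
  by rewrite -/(fg_one X) !gmulf1.
rewrite -cat1s fg_classM !gmulfM IHw; congr (_ * _).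
case: b; first exact: ff'.
by rewrite -[[:: _]]/(inv_word [:: (e, true)]) fg_classV !gmulfV; congr (_^-1); exact: ff'.
Qed.

Variables (G : graph) (o : orientation G) (H : groupType).

(** The chosen orientations disappear: a homomorphism given on darts in a way
    compatible with reversal is evaluated dart by dart, whatever [o] is. *)
Lemma fg_lift_dart_elt (h : dart G -> H) d :
  (forall c, h (dart_rev c) = (h c)^-1) ->
  fg_lift (fun e => h (e, o e)) (dart_elt o d) = h d.
Proof.
case: d => e b hV; rewrite /dart_elt /=; case: eqP => [->|/eqP nb].
  exact: fg_lift_gen.
rewrite gmulfV /= fg_lift_gen -hV; congr h.
by rewrite /dart_rev /inv_letter /=; case: b (o e) nb => [] [].
Qed.

Lemma fg_lift_edge_word (h : dart G -> H) (v : vertex G) (p : closed_walk v) :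
  (forall c, h (dart_rev c) = (h c)^-1) ->
  fg_lift (fun e => h (e, o e)) (edge_word o v (pi1_class p))
    = \prod_(d <- walk_darts p) h d.
Proof.
move=> hV; rewrite edge_word_class.
rewrite gmulf_prod.
by apply: eq_bigr => d _; exact: fg_lift_dart_elt.
Qed.

End FreeGroupMorphisms.

(** * Walks in connected and 2-edge connected graphs *)

Section Walks.
Variable G : graph.

Lemma dart_revK : involutive (@dart_rev G).
Proof. exact: inv_letterK. Qed.

Lemma dart_rev_neq (d : dart G) : dart_rev d != d.
Proof. by case: d => e []; rewrite xpair_eqE andbF. Qed.

Lemma adj_connect_sym : connect_sym (@adj G).
Proof.
apply: sym_connect_sym => x y; apply/existsP/existsP => -[[e b] /andP[sx ty]];
  by exists (e, ~~ b); rewrite /dart_src /dart_tgt /= ?negbK; apply/andP.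
Qed.

Lemma connect_walk x y : connect (@adj G) x y -> exists p, is_walk x p y.
Proof.
case/connectP=> s; elim: s x => [x _ ->|z s IHs x /= /andP[/existsP[d /andP[sd td]] zs] yE].
  by exists [::]; rewrite /=.
have [p pW] := IHs _ zs yE; exists (d :: p).
by rewrite /= sd (eqP td).
Qed.

Lemma exists_walk x y : n_components G <= 1 -> exists p : seq (dart G), is_walk x p y.
Proof.
move=> /card_le1_eqP G1; apply: connect_walk.
rewrite -(root_connect adj_connect_sym).
by apply/eqP/esym/G1; rewrite !inE roots_root//; exact: adj_connect_sym.
Qed.

Lemma dart_out x y : n_components G <= 1 -> x != y ->
  exists d : dart G, dart_src d = x.
Proof.
move=> /exists_walk G1 xy; have [[|d p] /=] := G1 x y; first by rewrite (negPf xy).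
by case/andP=> /eqP dx _; exists d.
Qed.

End Walks.

(** Deleting an edge that is not a bridge leaves one component. *)
Lemma walk_avoiding (G : graph) (e : edge G) x y : two_edge_connected G ->
  exists2 p : seq (dart G), is_walk x p y & all (fun d => d.1 != e) p.
Proof.
case/andP=> /eqP G1 /forallP/(_ e); rewrite /cut_edge -leqNgt G1.
move=> /(@exists_walk (del_edge e) x y)[p].
elim: p x => [x /eqP ->|[e' b] p IHp x /andP[sd /IHp[q qW qe]]].
  by exists [::] => //=.
exists ((val e', b) :: q); rewrite /=; last by rewrite (valP e').
by rewrite qW andbT; exact: sd.
Qed.

(** * Heisenberg transport along walks *)

Section Coboundary.
Local Open Scope ring_scope.
Variables (R : comNzRingType) (G : graph) (f : vertex G -> R).

Definition coboundary (d : dart G) : R := f (dart_tgt d) - f (dart_src d).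

Lemma coboundary_rev d : coboundary (dart_rev d) = - coboundary d.
Proof.
by rewrite /coboundary opprB /dart_src /dart_tgt /= negbK.
Qed.

Lemma sum_coboundary x p y : is_walk x p y -> \sum_(d <- p) coboundary d = f y - f x.
Proof.
elim: p x => [x /eqP ->|d p IHp x /= /andP[/eqP <- /IHp pE]].
  by rewrite big_nil subrr.
by rewrite big_cons pE addrC subrKA.
Qed.

(** The corner term is the one that makes the corner coordinate of a walk
    depend on the walk only through its start and the integral of [b]. The
    constant [z] normalises [f], and in use is its value at the base point. *)
Definition heis_gauge (z : R) (b : dart G -> R) (d : dart G) : heisenberg R :=
  heis (coboundary d) (b d) (- (f (dart_src d) - z) * b d).

Lemma heis_gauge_rev z b d : b (dart_rev d) = - b d ->
  heis_gauge z b (dart_rev d) = ((heis_gauge z b d)^-1)%g.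
Proof.
move=> bV; rewrite heisV /heis_gauge coboundary_rev bV; congr heis.
rewrite /coboundary [dart_src (dart_rev d)]/(dart_tgt d); ring.
Qed.

Lemma heis_gauge_walk z b x p y : is_walk x p y ->
  (\prod_(d <- p) heis_gauge z b d)%g
    = heis (f y - f x) (\sum_(d <- p) b d) (- (f x - z) * \sum_(d <- p) b d).
Proof.
elim: p x => [x /eqP ->|d p IHp x /= /andP[/eqP <- /IHp pE]].
  by rewrite !big_nil subrr mulr0.
by rewrite !big_cons pE heisM /coboundary; congr heis; ring.
Qed.

End Coboundary.

(** * The vertex map of an inclusion of truncated images *)

Section Inclusion.
Local Open Scope ring_scope.
Variables (k : fieldType) (G G' : graph) (v0 : vertex G) (v0' : vertex G').
Variables (o : orientation G) (o' : orientation G') (phi : dart G -> dart G').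
Hypothesis phiV : forall d, phi (dart_rev d) = dart_rev (phi d).
Hypothesis phi_sub : truncation_map k (dart_hom o o' phi) 2 @`
      range (truncation_map k (edge_word o v0) 2)
    `<=` range (truncation_map k (edge_word o' v0') 2).

(** The corner coordinate of the homomorphism defined by [h] extends to a linear
    form that kills [J^3], so it is well defined on the truncation. It vanishes
    on the image of [pi1(G', v0')], which contains the image under [phi] of each
    closed walk at [v0]. *)
Lemma heis_transfer (h : dart G' -> heisenberg k) :
  (forall d, h (dart_rev d) = (h d)^-1)%g ->
  (forall p, is_walk v0' p v0' -> heis_c (\prod_(d <- p) h d)%g = 0) ->
  forall p, is_walk v0 p v0 -> heis_c (\prod_(d <- p) h (phi d))%g = 0.
Proof.
move=> hV h0 p pW; pose gamma := pi1_class (ClosedWalk pW).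
pose rho := fg_lift (fun e => h (e, o' e)).
pose L : group_algebra k (free_group (edge G')) -> k^o :=
  linext (fun g => heis_c (rho g) : k^o).
have [|s' _] := phi_sub (t :=
  truncation_map k (dart_hom o o' phi) 2
    (truncation_map k (edge_word o v0) 2 (tr 2 (ga k gamma)))).
  by exists (truncation_map k (edge_word o v0) 2 (tr 2 (ga k gamma))).
rewrite -[s']trK !truncation_mapE !ga_map_ga => /trP eqJ.
have : L (ga_map (edge_word o' v0') (repr s')
    - ga k (dart_hom o o' phi (edge_word o v0 gamma))) = 0.
  exact: heis_c_aug_pow eqJ.
rewrite /L raddfB /= linext_ga linext_ga_map linext0 => [|g /=]; last first.
  rewrite -[g]pi1_classK /rho fg_lift_edge_word// h0//; exact: closed_walkP.
move/eqP; rewrite sub0r oppr_eq0 => /eqP <-; congr heis_c.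
have phi_hV c : dart_elt o' (phi (dart_rev c)) = ((dart_elt o' (phi c))^-1)%g.
  by rewrite phiV dart_elt_rev.
rewrite /dart_hom (@fg_lift_edge_word _ o _ (dart_elt o' \o phi))//.
rewrite [RHS](gmulf_prod (fg_lift _)); apply: eq_bigr => d _.
by rewrite /= fg_lift_dart_elt.
Qed.


Hypothesis G2 : two_edge_connected G.
Hypothesis phi_inj : injective phi.

(** This determines [f (src (phi d))] from a walk ending at [src d] that knows
    nothing else about [d]. Any walk [q] may be used, because the sum depends
    only on its endpoint; the proof evaluates it on a walk [q1] that avoids the
    edge of [d]. *)
Lemma src_phi (f : vertex G' -> k) d q : is_walk v0 q (dart_src d) ->
  f (dart_src (phi d)) = f v0' + \sum_(c <- q) coboundary f (phi c).
Proof.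
move=> qW.
(* The linear part: additive functions are corner coordinates of central elements. *)
have sum0 p : is_walk v0 p v0 -> \sum_(c <- p) coboundary f (phi c) = 0.
  move=> pW; have := @heis_transfer (fun c => heis 0 0 (coboundary f c)) _ _ p pW.
  rewrite heis_prod_c; apply=> [c|p' p'W].
    by rewrite heisV coboundary_rev !oppr0 mul0r addr0.
  by rewrite heis_prod_c (sum_coboundary f p'W) subrr.
have [q1 q1W q1d] := walk_avoiding d.1 v0 (dart_src d) G2.
have [r rW rd] := walk_avoiding d.1 (dart_tgt d) v0 G2.
have loopW p : is_walk v0 p (dart_src d) -> is_walk v0 (p ++ d :: r) v0.
  by move=> pW; apply: is_walk_cat pW _; rewrite /= eqxx.
have -> : \sum_(c <- q) coboundary f (phi c) = \sum_(c <- q1) coboundary f (phi c).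
  have := etrans (sum0 _ (loopW _ qW)) (esym (sum0 _ (loopW _ q1W))).
  by rewrite !big_cat => /addIr.
(* With this [b], only the passage of [q1 ++ d :: r] through [d] contributes. *)
pose b (c : dart G') : k := (c == phi d)%:R - (c == dart_rev (phi d))%:R.
have bV c : b (dart_rev c) = - b c.
  rewrite /b opprB (inj_eq (inv_inj (@dart_revK _))).
  by rewrite (can2_eq (@dart_revK _) (@dart_revK _)).
have b0 p : all (fun c => c.1 != d.1) p ->
    (\prod_(c <- p) heis_gauge f (f v0') b (phi c))%g
      = heis (\sum_(c <- p) coboundary f (phi c)) 0 0.
  move=> /allP pd; rewrite -heis_prod_a; apply: eq_big_seq => c /pd cd.
  suff bc : b (phi c) = 0 by rewrite /heis_gauge bc mulr0.
  rewrite /b -phiV !(inj_eq phi_inj).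
  by do 2![case: eqP => [cE|_]; first by rewrite cE eqxx in cd]; rewrite subrr.
have bd : b (phi d) = 1.
  by rewrite /b eqxx -phiV (inj_eq phi_inj) eq_sym (negPf (dart_rev_neq d)) subr0.
have : heis_c (\prod_(c <- q1 ++ d :: r) heis_gauge f (f v0') b (phi c))%g = 0.
  apply: heis_transfer (loopW _ q1W) => [c|p pW]; first exact: heis_gauge_rev.
  by rewrite (heis_gauge_walk f _ b pW) subrr oppr0 mul0r.
rewrite big_cat big_cons /= !b0// /heis_gauge bd !heisM.
rewrite /heis_a /heis_b /heis_c /= => h0.
by apply/eqP; rewrite eq_sym -subr_eq0; apply/eqP; rewrite -[RHS]h0; ring.
Qed.

(** The functions [f] of [src_phi] separate vertices. Darts with the same source
    admit the same [q]; the empty [q] handles darts at the base point. A graph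
    without darts is a single vertex, whence the default value [v0']. *)
Lemma vertex_map : exists phi0 : vertex G -> vertex G',
  phi0 v0 = v0' /\ forall d, dart_src (phi d) = phi0 (dart_src d).
Proof.
have separated (y z : vertex G') :
    (forall f : vertex G' -> k, f y = f z) -> y = z.
  move=> /(_ (fun x => (x == z)%:R)); rewrite eqxx; case: eqP => // _ /eqP.
  by rewrite eq_sym oner_eq0.
have src_eq d d' : dart_src d = dart_src d' -> dart_src (phi d) = dart_src (phi d').
  move=> dd'; have [q qW _] := walk_avoiding d.1 v0 (dart_src d) G2.
  by apply: separated => f; rewrite (src_phi f qW) (@src_phi f d' q)// -dd'.
have src0 d : dart_src d = v0 -> dart_src (phi d) = v0'.
  move=> dv0; apply: separated => f.
  by rewrite (@src_phi f d [::]) ?big_nil ?addr0//= dv0.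
exists (fun x => if [pick d | dart_src d == x] is Some d then dart_src (phi d)
                 else v0').
split=> [|d]; first by case: pickP => // d /eqP/src0.
by case: pickP => [d' /eqP/esym/src_eq //|/(_ d)]; rewrite eqxx.
Qed.

End Inclusion.

(** * Inverting the map of edges, and the theorem *)

Section Functoriality.
Variables (k : fieldType) (Gam Gam' : groupType).
Variables (f : UMagmaMorphism.type Gam Gam') (f' : UMagmaMorphism.type Gam' Gam).

Lemma truncation_mapK n : cancel f f' ->
  cancel (truncation_map k f n) (truncation_map k f' n).
Proof.
move=> fK x; rewrite -[x]trK !truncation_mapE; congr tr.
apply: (@ga_ext _ _ _ (ga_map f' \o ga_map f) idfun) => g /=.
by rewrite !ga_map_ga fK.
Qed.

End Functoriality.

Lemma dart_homK (G G' : graph) (o : orientation G) (o' : orientation G')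
    (phi : dart G -> dart G') (psi : dart G' -> dart G) :
  (forall d, psi (dart_rev d) = dart_rev (psi d)) -> cancel phi psi ->
  cancel (dart_hom o o' phi) (dart_hom o' o psi).
Proof.
move=> psiV phiK x.
have ext := @fg_morphism_ext _ _ (dart_hom o' o psi \o dart_hom o o' phi) idfun.
apply: (ext _ x) => {x} e /=.
rewrite [dart_hom o o' phi _]fg_lift_gen.
rewrite [LHS](@fg_lift_dart_elt _ o' _ (dart_elt o \o psi)) /=; last first.
  by move=> c; rewrite psiV dart_elt_rev.
by rewrite phiK /dart_elt eqxx.
Qed.

Theorem theorem1p1 (k : fieldType) (G G' : graph)
    (v0 : vertex G) (v0' : vertex G')
    (o : orientation G) (o' : orientation G')
    (phi : dart G -> dart G') :
  two_edge_connected G -> two_edge_connected G' ->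
  dart_bijection phi ->
  truncation_map k (dart_hom o o' phi) 2 @`
      range (truncation_map k (edge_word o v0) 2)
    = range (truncation_map k (edge_word o' v0') 2) ->
  graph_iso_at phi v0 v0'.
Proof.
move=> G2 G2' [[psi phiK psiK] phiV] eqR.
have psiV d : psi (dart_rev d) = dart_rev (psi d).
  by apply: (can_inj phiK); rewrite psiK phiV psiK.
have sub : truncation_map k (dart_hom o o' phi) 2 @`
      range (truncation_map k (edge_word o v0) 2)
    `<=` range (truncation_map k (edge_word o' v0') 2) by rewrite eqR.
have sub' : truncation_map k (dart_hom o' o psi) 2 @`
      range (truncation_map k (edge_word o' v0') 2)
    `<=` range (truncation_map k (edge_word o v0) 2).
  rewrite -eqR => _ [_ [x xS <-] <-].
  by rewrite (truncation_mapK (dart_homK o o' psiV phiK)).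
have [phi0 [phi0v phi0E]] := vertex_map phiV sub G2 (can_inj phiK).
have [psi0 [psi0v psi0E]] := vertex_map psiV sub' G2' (can_inj psiK).
have dart_at (H : graph) (x y : vertex H) : two_edge_connected H -> x != y ->
    exists d : dart H, dart_src d = x.
  by case/andP=> /eqP H1 _; apply: dart_out; rewrite H1.
exists phi0; split=> // [|d]; last first.
  by split; rewrite ?phi0E// -[dart_tgt (phi d)]/(dart_src (dart_rev (phi d))) -phiV phi0E.
exists psi0 => [x|y].
  have [->|/(dart_at _ _ _ G2)[d <-]] := eqVneq x v0; first by rewrite phi0v psi0v.
  by rewrite -phi0E -psi0E phiK.
have [->|/(dart_at _ _ _ G2')[d <-]] := eqVneq y v0'; first by rewrite psi0v phi0v.
by rewrite -psi0E -phi0E psiK.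
Qed.
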